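(* The extremals of the resistance functional corresponding to the second factor of its Euler–Lagrange equations, that is, the curves $\gamma(t)=\Psi(u(t),v(t))$ for which $$f(u)u''-\frac{f(u)u'}{v'}v''-f'(u)u'^2=0$$ identically in the domain, are the loxodromes of $\Sigma$, that is, curves that make a constant angle with the meridians, which are given by the ODE $$u'=k\,v'f(u),$$ where $k$ is a positive constant. The resistance of the loxodrome defined in $[v_0,v_1]$ is $$\mathcal{R}=\frac{v_1-v_0}{1+k^2}.$$
   Context: $\Sigma$ is a Riemannian surface with a parametrization $\Psi:\Omega=I\times J\subset\mathbb{R}^2\to\Sigma$ in coordinates $(u,v)$ for which the metric is $ds^2=du^2+f(u)^2dv^2$, where $f=f(u)$ is a smooth positive function. Meridians are the curves $v=\text{constant}$ and parallels are the curves $u=\text{constant}$. For a regular curve $\gamma(t)=\Psi(u(t),v(t))$, $t\in[a,b]$, primes denote derivatives with respect to $t$ (except $f'$, the derivative of $f$ with respect to $u$), and the resistance functional is $$\mathcal{R}[\gamma]=\int_a^b\frac{v'^3f(u)^2}{u'^2+v'^2f(u)^2}\,dt.$$ Its Euler–Lagrange equations are $$v'^3\big(3u'^2-f(u)^2v'^2\big)\Big[f(u)u''-\frac{f(u)u'}{v'}v''-f'(u)u'^2\Big]=0,$$ $$u'v'^2\big(3u'^2-f(u)^2v'^2\big)\Big[f(u)u''-\frac{f(u)u'}{v'}v''-f'(u)u'^2\Big]=0.$$ Extremals are the smooth solutions of these equations; the second factor is the expression in square brackets. A loxodrome ''defined in $[v_0,v_1]$'' is one along which $v$ runs from $v_0$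 to $v_1$.
   Formalization: Meridians, which make a constant angle but do not solve the equation, are excluded from the loxodromes; the ODE is proved with k any real constant (parallels have k=0, mirror images k<0), and k is positive exactly when u'v'>0 at some point of the curve. *)

(* Defs.v *)
From Stdlib Require Import Reals.
From Coquelicot Require Import Coquelicot.
Open Scope R_scope.

Definition smooth_on (D : R -> Prop) (g : R -> R) : Prop :=
  forall (n : nat) (x : R), D x -> ex_derive_n g n x.

Definition is_interval (D : R -> Prop) : Prop :=
  forall x y z : R, D x -> D z -> x <= y <= z -> D y.

(** A coordinate patch I x J carrying the metric du^2 + f(u)^2 dv^2; the
    surface is identified with the patch through its parametrization, so the
    metric is the pulled-back one. *)
Record surface : Type := Surface {
  dom_u : R -> Prop;
  dom_v : R -> Prop;
  warp : R -> R;
  dom_u_open : open dom_u;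
  dom_v_open : open dom_v;
  dom_u_interval : is_interval dom_u;
  dom_v_interval : is_interval dom_v;
  warp_smooth : smooth_on dom_u warp;
  warp_pos : forall x : R, dom_u x -> 0 < warp x
}.

(** Tangent vectors are written in the basis (d/du, d/dv). *)
Definition metric (Sigma : surface) (p X Y : R * R) : R :=
  fst X * fst Y + (warp Sigma (fst p)) ^ 2 * (snd X * snd Y).

Definition tangent_norm (Sigma : surface) (p X : R * R) : R :=
  sqrt (metric Sigma p X X).

Definition tangent_angle (Sigma : surface) (p X Y : R * R) : R :=
  acos (metric Sigma p X Y / (tangent_norm Sigma p X * tangent_norm Sigma p Y)).

Record curve : Type := Curve {
  cu : R -> R;
  cv : R -> R;
  ca : R;
  cb : R
}.

Definition point (c : curve) (t : R) : R * R := (cu c t, cv c t).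

Definition velocity (c : curve) (t : R) : R * R :=
  (Derive (cu c) t, Derive (cv c) t).

(** Smoothness on the closed interval means smoothness on an open interval
    around it, so that the two-sided derivatives at the endpoints make sense. *)
Definition regular_curve (Sigma : surface) (c : curve) : Prop :=
  ca c < cb c /\
  (exists eps : R, 0 < eps /\
     smooth_on (fun t => ca c - eps < t < cb c + eps) (cu c) /\
     smooth_on (fun t => ca c - eps < t < cb c + eps) (cv c)) /\
  (forall t : R, ca c <= t <= cb c ->
     dom_u Sigma (cu c t) /\ dom_v Sigma (cv c t) /\ velocity c t <> (0, 0)).

Definition resistance_density (Sigma : surface) (c : curve) (t : R) : R :=
  (Derive (cv c) t) ^ 3 * (warp Sigma (cu c t)) ^ 2 /
  ((Derive (cu c) t) ^ 2 + (Derive (cv c) t) ^ 2 * (warp Sigma (cu c t)) ^ 2).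

Definition resistance (Sigma : surface) (c : curve) : R :=
  RInt (resistance_density Sigma c) (ca c) (cb c).

Definition first_factor (Sigma : surface) (c : curve) (t : R) : R :=
  3 * (Derive (cu c) t) ^ 2 - (warp Sigma (cu c t)) ^ 2 * (Derive (cv c) t) ^ 2.

(** The bracket of the Euler-Lagrange equations; it is meaningful only where
    v' <> 0.  Where v' = 0 it is a finite junk value, which is harmless in the
    Euler-Lagrange equations: they hold there, as they do after distributing
    the factor v'^3 or v'^2 over the bracket. *)
Definition second_factor (Sigma : surface) (c : curve) (t : R) : R :=
  warp Sigma (cu c t) * Derive_n (cu c) 2 t
  - warp Sigma (cu c t) * Derive (cu c) t / Derive (cv c) t * Derive_n (cv c) 2 t
  - Derive (warp Sigma) (cu c t) * (Derive (cu c) t) ^ 2.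

Definition euler_lagrange (Sigma : surface) (c : curve) (t : R) : Prop :=
  (Derive (cv c) t) ^ 3 * first_factor Sigma c t * second_factor Sigma c t = 0 /\
  Derive (cu c) t * (Derive (cv c) t) ^ 2
    * first_factor Sigma c t * second_factor Sigma c t = 0.

Definition extremal (Sigma : surface) (c : curve) : Prop :=
  regular_curve Sigma c /\
  forall t : R, ca c <= t <= cb c -> euler_lagrange Sigma c t.

Definition second_factor_extremal (Sigma : surface) (c : curve) : Prop :=
  extremal Sigma c /\
  forall t : R, ca c <= t <= cb c ->
    Derive (cv c) t <> 0 /\ second_factor Sigma c t = 0.

Definition meridian (c : curve) : Prop :=
  exists v0 : R, forall t : R, ca c <= t <= cb c -> cv c t = v0.

(** The meridian through a point has tangent vector d/du = (1, 0). *)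
Definition loxodrome (Sigma : surface) (c : curve) : Prop :=
  exists theta : R, forall t : R, ca c <= t <= cb c ->
    tangent_angle Sigma (point c t) (velocity c t) (1, 0) = theta.

Definition loxodrome_ode (Sigma : surface) (k : R) (c : curve) : Prop :=
  forall t : R, ca c <= t <= cb c ->
    Derive (cu c) t = k * Derive (cv c) t * warp Sigma (cu c t).

(* Main.v *)
Require Import Defs.
From Stdlib Require Import Reals Ranalysis5 Lra.
From Coquelicot Require Import Coquelicot.
Open Scope R_scope.

(** Where [v' <> 0], a curve has a slope against the meridians, the ratio
    [u' / (v' f(u))] of its meridional speed to its speed along the parallel; it
    is the cotangent of the angle with the meridian.  The quotient rule shows
    that the bracket of the Euler-Lagrange equations is the derivative of this
    slope, up to the nonvanishing factor [v' f(u)^2] ([is_derive_slope]).  So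
    the bracket vanishes along the curve exactly when the slope is a constant
    [k], which is the equation [u' = k v' f(u)].

    The angle itself is the arc cosine of [u' / N], where
    [N = sqrt (u'^2 + f(u)^2 v'^2)].  If [u' = k v' f(u)], this cosine is
    [k / sqrt (1 + k^2)] up to the sign of [v'].  Conversely, if the cosine is a
    constant [C], then [N^2 (1 - C^2) = f(u)^2 v'^2]: either [C^2 = 1] and [v]
    is constant, so that the curve is a meridian, or [v'] never vanishes and
    [k] is [C / sqrt (1 - C^2)] up to the sign of [v'].  In both directions the
    sign of [v'] is harmless because [v'], continuous and without zeros, keeps
    the same sign all along the curve.

    Along a loxodrome the resistance density collapses to [v' / (1 + k^2)], and
    the fundamental theorem of calculus gives the resistance. *)

(** * Functions on a closed interval *)

(** The endpoints are the point of this lemma: there [f] is constant on one side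
    only, but a two-sided derivative is determined by one side. *)
Lemma is_derive_const_on (f : R -> R) (a b k x l : R) :
  a < b -> (forall t, a <= t <= b -> f t = k) -> a <= x <= b ->
  is_derive f x l -> l = 0.
Proof.
intros Hab Hf Hx Hd.
apply is_derive_Reals in Hd.
destruct (Req_dec l 0) as [|Hl]; [easy|exfalso].
destruct (Hd (Rabs l) (Rabs_pos_lt _ Hl)) as [[d Hd0] Hlim]; simpl in Hlim.
(* Some admissible increment stays in the interval, where the difference
   quotient is 0. *)
assert (Hh : exists h, h <> 0 /\ Rabs h < d /\ a <= x + h <= b).
{ destruct (Rlt_le_dec x b) as [Hb|Hb].
  - exists (Rmin (d / 2) (b - x)).
    pose proof (Rmin_l (d / 2) (b - x)); pose proof (Rmin_r (d / 2) (b - x)).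
    assert (0 < Rmin (d / 2) (b - x)) by (apply Rmin_glb_lt; lra).
    rewrite Rabs_pos_eq; lra.
  - exists (- Rmin (d / 2) (x - a)).
    pose proof (Rmin_l (d / 2) (x - a)); pose proof (Rmin_r (d / 2) (x - a)).
    assert (0 < Rmin (d / 2) (x - a)) by (apply Rmin_glb_lt; lra).
    rewrite Rabs_Ropp, Rabs_pos_eq; lra. }
destruct Hh as (h & Hh0 & Hhd & Hxh).
specialize (Hlim h Hh0 Hhd).
rewrite (Hf (x + h) Hxh), (Hf x Hx) in Hlim.
replace ((k - k) / h - l) with (- l) in Hlim by (field; exact Hh0).
rewrite Rabs_Ropp in Hlim; lra.
Qed.

Lemma const_on_of_derive_0 (f : R -> R) (a b x : R) :
  (forall t, a <= t <= b -> is_derive f t 0) -> a <= x <= b -> f x = f a.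
Proof.
intros Hf Hx.
destruct (Req_dec a x) as [<-|Hne]; [easy|].
symmetry; apply (eq_is_derive f a x); [|lra].
intros t Ht; apply Hf; lra.
Qed.

Lemma nonvanishing_sign (g : R -> R) (a b : R) :
  (forall t, a <= t <= b -> continuity_pt g t) ->
  (forall t, a <= t <= b -> g t <> 0) ->
  exists s, s ^ 2 = 1 /\ forall t, a <= t <= b -> Rabs (g t) = s * g t.
Proof.
(* The positive case, to be applied to [g] and to its opposite. *)
assert (Hpos : forall h : R -> R,
  (forall t, a <= t <= b -> continuity_pt h t) ->
  (forall t, a <= t <= b -> h t <> 0) ->
  0 < h a -> forall t, a <= t <= b -> 0 < h t).
{ intros h Hc Hn Ha t Ht.
  destruct (Rtotal_order (h t) 0) as [Hlt|[He|Hgt]]; [|now destruct (Hn t Ht)|easy].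
  exfalso.
  assert (Hat : a < t) by (destruct (Req_dec a t) as [<-|]; lra).
  destruct (IVT_interv (fun x => - h x) a t) as [z [Hz Hz0]]; try lra.
  - intros x Hx; apply continuity_pt_opp, Hc; lra.
  - apply (Hn z); lra. }
intros Hc Hn.
destruct (Rle_dec a b) as [Hab|Hab]; [|exists 1; split; [ring|intros; lra]].
destruct (Rtotal_order (g a) 0) as [Hlt|[He|Hgt]].
- exists (-1); split; [ring|intros t Ht].
  assert (0 < - g t).
  { apply (Hpos (fun x => - g x)); try easy.
    - intros x Hx; now apply continuity_pt_opp, Hc.
    - intros x Hx; specialize (Hn x Hx); lra.
    - lra. }
  rewrite Rabs_left; lra.
- destruct (Hn a); lra.
- exists 1; split; [ring|intros t Ht].
  pose proof (Hpos g Hc Hn Hgt t Ht).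
  rewrite Rabs_pos_eq; lra.
Qed.

(** * The slope against the meridians *)

Section RegularCurve.

Variables (Sigma : surface) (c : curve).
Hypothesis Hc : regular_curve Sigma c.

Local Notation u' t := (Derive (cu c) t).
Local Notation v' t := (Derive (cv c) t).
Local Notation f t := (warp Sigma (cu c t)).
Local Notation "'on_curve' t" := (ca c <= t <= cb c) (at level 10, t at level 9).

Lemma curve_ex_derive_n (n : nat) (t : R) :
  on_curve t -> ex_derive_n (cu c) n t /\ ex_derive_n (cv c) n t.
Proof.
intros Ht; destruct Hc as (_ & (eps & Heps & Hu & Hv) & _).
split; [apply Hu|apply Hv]; lra.
Qed.

Lemma warp_curve_pos (t : R) : on_curve t -> 0 < f t.
Proof.
intros Ht; destruct Hc as (_ & _ & Hr).
apply warp_pos; now destruct (Hr t Ht).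
Qed.

Lemma velocity_neq0 (t : R) : on_curve t -> u' t = 0 -> v' t <> 0.
Proof.
intros Ht Hu Hv; destruct Hc as (_ & _ & Hr).
destruct (Hr t Ht) as (_ & _ & Hn).
now apply Hn; unfold velocity; rewrite Hu, Hv.
Qed.

Lemma derive_v_sign :
  (forall t, on_curve t -> v' t <> 0) ->
  exists s, s ^ 2 = 1 /\ forall t, on_curve t -> Rabs (v' t) = s * v' t.
Proof.
apply nonvanishing_sign.
intros t Ht; apply continuity_pt_filterlim, (ex_derive_continuous (Derive (cv c))).
exact (proj2 (curve_ex_derive_n 2 t Ht)).
Qed.

Definition slope (t : R) : R := u' t / (v' t * f t).

(** The quotient rule: the bracket of the Euler-Lagrange equations is the
    numerator of the derivative of the slope, divided by [v']. *)
Lemma is_derive_slope (t : R) :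
  on_curve t -> v' t <> 0 ->
  is_derive slope t (second_factor Sigma c t / (v' t * f t ^ 2)).
Proof.
intros Ht Hv.
pose proof (warp_curve_pos t Ht) as Hf.
destruct (curve_ex_derive_n 1 t Ht) as [Hu1 _].
destruct (curve_ex_derive_n 2 t Ht) as [Hu2 Hv2].
assert (Hw : ex_derive (warp Sigma) (cu c t)).
{ destruct Hc as (_ & _ & Hr).
  apply (warp_smooth Sigma 1%nat); now destruct (Hr t Ht). }
change (ex_derive (cu c) t) in Hu1.
change (ex_derive (Derive (cu c)) t) in Hu2.
change (ex_derive (Derive (cv c)) t) in Hv2.
apply Derive_correct in Hu1, Hu2, Hv2, Hw.
evar_last.
- apply is_derive_div; [exact Hu2| |].
  + apply (is_derive_mult (Derive (cv c)) (fun s => warp Sigma (cu c s)));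
      [exact Hv2| |exact Rmult_comm].
    apply (is_derive_comp (warp Sigma) (cu c)); [exact Hw|exact Hu1].
  + apply Rmult_integral_contrapositive; split; lra.
- unfold second_factor, plus, mult, scal; simpl; unfold mult; simpl.
  change (fun x => Derive (fun y => cu c y) x) with (Derive (cu c)).
  change (fun x => Derive (fun y => cv c y) x) with (Derive (cv c)).
  field; split; lra.
Qed.

(** Regularity of the curve enters here: a zero of [v'] would also be a zero of
    [u' = k v' f(u)], and the velocity would vanish. *)
Lemma loxodrome_ode_derive_v (k t : R) :
  loxodrome_ode Sigma k c -> on_curve t -> v' t <> 0.
Proof.
intros Hode Ht Hv; apply (velocity_neq0 t Ht); [|exact Hv].
rewrite (Hode t Ht), Hv; ring.
Qed.

(** The slope has derivative zero, so its value at the initial point serves as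
    [k]. *)
Lemma second_factor_loxodrome_ode :
  second_factor_extremal Sigma c -> exists k, loxodrome_ode Sigma k c.
Proof.
intros [_ H]; exists (slope (ca c)); intros t Ht.
rewrite <- (const_on_of_derive_0 slope (ca c) (cb c) t); [| |exact Ht].
- pose proof (warp_curve_pos t Ht); destruct (H t Ht) as [Hv _].
  unfold slope; field; split; lra.
- intros s Hs; destruct (H s Hs) as [Hv H0].
  pose proof (is_derive_slope s Hs Hv) as Hd.
  now rewrite H0, Rdiv_0_l in Hd.
Qed.

Lemma loxodrome_ode_second_factor (k : R) :
  loxodrome_ode Sigma k c -> second_factor_extremal Sigma c.
Proof.
intros Hode.
assert (H0 : forall t, on_curve t -> second_factor Sigma c t = 0).
{ intros t Ht.
  pose proof (loxodrome_ode_derive_v k t Hode Ht) as Hv.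
  pose proof (warp_curve_pos t Ht) as Hf.
  assert (Hslope : forall s, on_curve s -> slope s = k).
  { intros s Hs; pose proof (warp_curve_pos s Hs).
    pose proof (loxodrome_ode_derive_v k s Hode Hs).
    unfold slope; rewrite (Hode s Hs); field; split; lra. }
  pose proof (is_derive_const_on slope _ _ k t _ (proj1 Hc) Hslope Ht
    (is_derive_slope t Ht Hv)) as Hz.
  replace (second_factor Sigma c t)
    with (second_factor Sigma c t / (v' t * f t ^ 2) * (v' t * f t ^ 2))
    by (field; split; lra).
  rewrite Hz; ring. }
split; [split; [exact Hc|]|].
- intros t Ht; unfold euler_lagrange; rewrite (H0 t Ht); split; ring.
- intros t Ht; split; [now apply (loxodrome_ode_derive_v k)|now apply H0].
Qed.

(** * The angle with the meridians *)

Definition speed (t : R) : R := sqrt (u' t ^ 2 + f t ^ 2 * v' t ^ 2).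

Lemma speed_sqr (t : R) : speed t ^ 2 = u' t ^ 2 + f t ^ 2 * v' t ^ 2.
Proof.
apply pow2_sqrt, Rplus_le_le_0_compat; [apply pow2_ge_0|].
rewrite <- Rpow_mult_distr; apply pow2_ge_0.
Qed.

Lemma speed_pos (t : R) : on_curve t -> 0 < speed t.
Proof.
intros Ht; pose proof (warp_curve_pos t Ht) as Hf.
apply sqrt_lt_R0.
destruct (Req_dec (u' t) 0) as [Hu|Hu].
- pose proof (velocity_neq0 t Ht Hu) as Hv.
  rewrite Hu, <- Rpow_mult_distr.
  enough (0 < (f t * v' t) ^ 2) by lra.
  apply pow2_gt_0, Rmult_integral_contrapositive; split; lra.
- pose proof (pow2_gt_0 _ Hu); pose proof (pow2_ge_0 (f t * v' t)) as H2.
  rewrite Rpow_mult_distr in H2; lra.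
Qed.

Lemma meridian_angle_eq (t : R) :
  tangent_angle Sigma (point c t) (velocity c t) (1, 0) = acos (u' t / speed t).
Proof.
unfold tangent_angle, tangent_norm, metric, point, velocity, speed; simpl.
f_equal; f_equal; [ring|].
replace (1 * 1 + f t * (f t * 1) * (0 * 0)) with 1 by ring.
rewrite sqrt_1, Rmult_1_r; f_equal; ring.
Qed.

Lemma meridian_angle_cos (t : R) :
  on_curve t ->
  u' t =
  cos (tangent_angle Sigma (point c t) (velocity c t) (1, 0)) * speed t.
Proof.
intros Ht; pose proof (speed_pos t Ht) as Hs.
rewrite meridian_angle_eq, cos_acos; [field; lra|].
assert (Habs : Rabs (u' t) <= speed t).
{ rewrite <- (Rabs_pos_eq (speed t)) by lra.
  apply Rsqr_le_abs_0; rewrite !Rsqr_pow2, speed_sqr, <- Rpow_mult_distr.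
  pose proof (pow2_ge_0 (f t * v' t)); lra. }
apply Rabs_le_between.
rewrite Rabs_div, (Rabs_pos_eq (speed t)) by lra.
apply (Rmult_le_reg_r (speed t)); [exact Hs|].
field_simplify; lra.
Qed.

Lemma meridian_derive_v (t : R) : meridian c -> on_curve t -> v' t = 0.
Proof.
intros [v0 Hm] Ht.
apply (is_derive_const_on (cv c) (ca c) (cb c) v0 t);
  [exact (proj1 Hc)|exact Hm|exact Ht|].
apply Derive_correct; exact (proj2 (curve_ex_derive_n 1 t Ht)).
Qed.

Lemma loxodrome_ode_loxodrome (k : R) :
  loxodrome_ode Sigma k c -> loxodrome Sigma c /\ ~ meridian c.
Proof.
intros Hode.
assert (Hv : forall t, on_curve t -> v' t <> 0)
  by (intros t Ht; now apply (loxodrome_ode_derive_v k)).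
split.
- destruct (derive_v_sign Hv) as (s & Hs & Hsv).
  assert (Hk : 0 < 1 + k ^ 2) by (pose proof (pow2_ge_0 k); lra).
  pose proof (sqrt_lt_R0 _ Hk) as Hk1.
  exists (acos (s * k / sqrt (1 + k ^ 2))); intros t Ht.
  pose proof (warp_curve_pos t Ht) as Hf.
  specialize (Hv t Ht); specialize (Hsv t Ht).
  assert (Hs0 : s <> 0) by (intros ->; lra).
  rewrite meridian_angle_eq; f_equal.
  assert (Hsp : speed t = sqrt (1 + k ^ 2) * (f t * (s * v' t))).
  { unfold speed; rewrite (Hode t Ht).
    replace ((k * v' t * f t) ^ 2 + f t ^ 2 * v' t ^ 2)
      with ((1 + k ^ 2) * (f t * v' t) ^ 2) by ring.
    rewrite sqrt_mult by (try apply pow2_ge_0; lra).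
    rewrite <- Hsv, <- (Rsqr_pow2 (f t * v' t)), sqrt_Rsqr_abs, Rabs_mult.
    rewrite (Rabs_pos_eq (f t)); lra. }
  rewrite Hsp, (Hode t Ht).
  (* [s] lands in the denominator on one side and in the numerator on the
     other; they agree since [s ^ 2 = 1]. *)
  transitivity (s ^ 2 * k / (s * sqrt (1 + k ^ 2))).
  + rewrite Hs; field; repeat split; lra.
  + field; split; lra.
- intros Hm; destruct Hc as (Hab & _ & _).
  apply (Hv (ca c)); [lra|apply meridian_derive_v; [exact Hm|lra]].
Qed.

(** With [C] the constant cosine, [u' = C N] turns [N^2 = u'^2 + f(u)^2 v'^2]
    into [(1 - C^2) N^2 = f(u)^2 v'^2].  As [N > 0], [v'] either vanishes
    identically, on a meridian, or has no zero; then [N] can be eliminated by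
    taking square roots, because the sign of [v'] is constant. *)
Lemma loxodrome_loxodrome_ode :
  loxodrome Sigma c -> ~ meridian c -> exists k, loxodrome_ode Sigma k c.
Proof.
intros [theta Htheta] Hnm.
set (C := cos theta).
assert (HC : forall t, on_curve t -> u' t = C * speed t).
{ intros t Ht; rewrite (meridian_angle_cos t Ht), (Htheta t Ht); reflexivity. }
assert (Hpar : forall t, on_curve t ->
  (1 - C ^ 2) * speed t ^ 2 = (f t * v' t) ^ 2).
{ intros t Ht; pose proof (speed_sqr t) as Hsq.
  rewrite (HC t Ht) in Hsq.
  rewrite Rpow_mult_distr; lra. }
assert (HC1 : 0 <= 1 - C ^ 2).
{ unfold C; rewrite <- !Rsqr_pow2.
  pose proof (sin2_cos2 theta); pose proof (Rle_0_sqr (sin theta)); lra. }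
destruct (Req_dec (1 - C ^ 2) 0) as [HC0|HC0].
- exfalso; apply Hnm; exists (cv c (ca c)); intros t Ht.
  apply (const_on_of_derive_0 _ (ca c) (cb c)); [|exact Ht].
  intros s Hs; pose proof (warp_curve_pos s Hs) as Hf.
  assert (Hv : v' s = 0).
  { specialize (Hpar s Hs); rewrite HC0, Rmult_0_l in Hpar.
    destruct (Req_dec (v' s) 0) as [|Hv]; [easy|exfalso].
    apply (pow_nonzero (f s * v' s) 2); [|now symmetry].
    apply Rmult_integral_contrapositive; split; lra. }
  rewrite <- Hv.
  apply Derive_correct; exact (proj2 (curve_ex_derive_n 1 s Hs)).
- assert (Hv : forall t, on_curve t -> v' t <> 0).
  { intros t Ht Hv; specialize (Hpar t Ht).
    rewrite Hv, Rmult_0_r, pow_i in Hpar by auto.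
    apply Rmult_integral in Hpar; destruct Hpar as [|Hsp]; [easy|].
    pose proof (speed_pos t Ht).
    apply (pow_nonzero (speed t) 2); [lra|exact Hsp]. }
  destruct (derive_v_sign Hv) as (s & _ & Hsv).
  assert (Hq : 0 < sqrt (1 - C ^ 2)) by (apply sqrt_lt_R0; lra).
  exists (C * s / sqrt (1 - C ^ 2)); intros t Ht.
  pose proof (warp_curve_pos t Ht) as Hf; pose proof (speed_pos t Ht) as Hsp.
  assert (Hroot : sqrt (1 - C ^ 2) * speed t = f t * (s * v' t)).
  { rewrite <- (Hsv t Ht), <- (Rabs_pos_eq (f t)) by lra.
    rewrite <- Rabs_mult, <- sqrt_Rsqr_abs, Rsqr_pow2, <- (Hpar t Ht).
    rewrite sqrt_mult by (try apply pow2_ge_0; exact HC1).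
    rewrite sqrt_pow2; lra. }
  rewrite (HC t Ht).
  transitivity (C * (f t * (s * v' t)) / sqrt (1 - C ^ 2)).
  + rewrite <- Hroot; field; lra.
  + field; lra.
Qed.

(** * Orientation and resistance *)

Lemma loxodrome_ode_derive_prod (k t : R) :
  loxodrome_ode Sigma k c -> on_curve t -> (0 < u' t * v' t <-> 0 < k).
Proof.
intros Hode Ht.
pose proof (warp_curve_pos t Ht) as Hf.
pose proof (pow2_gt_0 _ (loxodrome_ode_derive_v k t Hode Ht)) as Hv.
pose proof (Rmult_lt_0_compat _ _ Hv Hf) as Hp.
rewrite (Hode t Ht).
replace (k * v' t * f t * v' t) with (k * (v' t ^ 2 * f t)) by ring.
split; intros H.
- apply (Rmult_lt_reg_r (v' t ^ 2 * f t)); lra.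
- now apply Rmult_lt_0_compat.
Qed.

(** Substituting [u' = k v' f(u)], the density becomes [v' / (1 + k^2)], whose
    antiderivative is [v / (1 + k^2)]. *)
Lemma is_RInt_resistance_density (k : R) :
  loxodrome_ode Sigma k c ->
  is_RInt (resistance_density Sigma c) (ca c) (cb c)
    ((cv c (cb c) - cv c (ca c)) / (1 + k ^ 2)).
Proof.
intros Hode.
assert (Hab : ca c < cb c) by exact (proj1 Hc).
assert (Hk : 0 < 1 + k ^ 2) by (pose proof (pow2_ge_0 k); lra).
apply (is_RInt_ext (fun t => scal (/ (1 + k ^ 2)) (v' t))).
{ rewrite Rmin_left, Rmax_right by lra; intros t Ht.
  assert (Ht' : on_curve t) by lra.
  pose proof (warp_curve_pos t Ht') as Hf.
  pose proof (loxodrome_ode_derive_v k t Hode Ht') as Hv.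
  unfold resistance_density, scal; simpl; unfold mult; simpl.
  rewrite (Hode t Ht').
  field; split; [|lra].
  replace (_ + _) with ((1 + k ^ 2) * (v' t * f t) ^ 2) by ring.
  apply Rmult_integral_contrapositive; split; [lra|].
  apply pow_nonzero, Rmult_integral_contrapositive; split; lra. }
replace ((cv c (cb c) - cv c (ca c)) / (1 + k ^ 2))
  with (scal (/ (1 + k ^ 2)) (minus (cv c (cb c)) (cv c (ca c)))).
2:{ unfold scal, minus, plus, opp; simpl; unfold mult; simpl; field; lra. }
apply (is_RInt_scal (V := R_NormedModule)), (is_RInt_derive (cv c));
  rewrite Rmin_left, Rmax_right by lra; intros t Ht.
- apply Derive_correct; exact (proj2 (curve_ex_derive_n 1 t Ht)).
- apply (ex_derive_continuous (Derive (cv c))).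
  exact (proj2 (curve_ex_derive_n 2 t Ht)).
Qed.

End RegularCurve.

Theorem theorem3p6 (Sigma : surface) (c : curve) (Hc : regular_curve Sigma c) :
  (second_factor_extremal Sigma c <-> loxodrome Sigma c /\ ~ meridian c) /\
  (second_factor_extremal Sigma c <-> exists k : R, loxodrome_ode Sigma k c) /\
  ((second_factor_extremal Sigma c /\
    exists t : R, ca c <= t <= cb c /\ 0 < Derive (cu c) t * Derive (cv c) t)
   <-> exists k : R, 0 < k /\ loxodrome_ode Sigma k c) /\
  (forall k v0 v1 : R,
     loxodrome_ode Sigma k c -> cv c (ca c) = v0 -> cv c (cb c) = v1 ->
     ex_RInt (resistance_density Sigma c) (ca c) (cb c) /\
     resistance Sigma c = (v1 - v0) / (1 + k ^ 2)).
Proof.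
split; [|split; [|split]].
- split.
  + intros H; destruct (second_factor_loxodrome_ode _ _ Hc H) as [k Hk].
    now apply (loxodrome_ode_loxodrome _ _ Hc k).
  + intros [Hl Hm]; destruct (loxodrome_loxodrome_ode _ _ Hc Hl Hm) as [k Hk].
    now apply (loxodrome_ode_second_factor _ _ Hc k).
- split.
  + now apply second_factor_loxodrome_ode.
  + intros [k Hk]; now apply (loxodrome_ode_second_factor _ _ Hc k).
- split.
  + intros [H (t & Ht & Hpos)].
    destruct (second_factor_loxodrome_ode _ _ Hc H) as [k Hk].
    exists k; split; [|exact Hk].
    now apply (loxodrome_ode_derive_prod _ _ Hc k t).
  + intros (k & Hpos & Hk); split.
    * now apply (loxodrome_ode_second_factor _ _ Hc k).
    * assert (Ht : ca c <= ca c <= cb c) by (destruct Hc; lra).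
      exists (ca c); split; [exact Ht|].
      now apply (loxodrome_ode_derive_prod _ _ Hc k).
- intros k v0 v1 Hk <- <-.
  pose proof (is_RInt_resistance_density _ _ Hc k Hk) as HI.
  split; [now exists ((cv c (cb c) - cv c (ca c)) / (1 + k ^ 2))|].
  now apply is_RInt_unique.
Qed.
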